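(* Let $\mathbf{T}=(T_1,\dots,T_n)\in\mathcal{B}_A(\mathcal{H})^n$. Then $$\omega_A(\mathbf{T})\le\inf_{\alpha,\beta}\frac{1}{\sqrt{\alpha+\beta}}\Big\|\sum_{k=1}^n\Big(\big(\tfrac{\alpha}{2}+\beta\big)T_k^{\sharp_A}T_k+\tfrac{\alpha}{2}T_kT_k^{\sharp_A}\Big)\Big\|_A^{1/2}\le\frac{1}{\sqrt2}\Big\|\sum_{k=1}^n\big(T_k^{\sharp_A}T_k+T_kT_k^{\sharp_A}\big)\Big\|_A^{1/2},$$ where the infimum is over all reals $\alpha,\beta\ge0$ with $(\alpha,\beta)\ne(0,0)$.
   Context: $\mathcal{H}$ is a non-trivial complex Hilbert space, $\mathcal{B}(\mathcal{H})$ the bounded linear operators on it, $A\in\mathcal{B}(\mathcal{H})$ a fixed positive operator ($\langle Ax,x\rangle\ge0$ for all $x$), $n\ge 1$ an integer. Put $\langle x,y\rangle_A=\langle Ax,y\rangle$ and $\|x\|_A=\langle Ax,x\rangle^{1/2}$. $\mathcal{B}_A(\mathcal{H})$ is the set of $T\in\mathcal{B}(\mathcal{H})$ for which there is $W\in\mathcal{B}(\mathcal{H})$ with $AW=T^*A$ (equivalently, $\mathcal{R}(T^*A)\subseteq\mathcal{R}(A)$); for such $T$, $T^{\sharp_A}=A^\dagger T^*A$ ($A^\dagger$ the Moore–Penrose inverse) is the unique bounded $W$ with $AW=T^*A$ and $\mathcal{R}(W)\subseteq\overline{\mathcal{R}(A)}$. Every $T\in\mathcal{B}_A(\mathcal{H})$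 satisfies $\|Tx\|_A\le c\|x\|_A$ for all $x$, for some $c>0$; for a single operator put $\|T\|_A=\sup_{\|x\|_A=1}\|Tx\|_A$. $\mathcal{B}_A(\mathcal{H})^n$ is the set of $n$-tuples of elements of $\mathcal{B}_A(\mathcal{H})$. For a tuple $\mathbf{T}$, $\omega_A(\mathbf{T})=\sup_{\|x\|_A=1}\big(\sum_{k=1}^n|\langle T_kx,x\rangle_A|^2\big)^{1/2}$. *)

(* Defs.v *)
(* A complex Hilbert space is a complete normed module [H]
   over [R[i]] (with [R : realType]) together with a positive definite
   hermitian form [dot : {dot H for conjC}], linear in its first argument,
   that induces the norm. *)
From HB Require Import structures.
From mathcomp Require Import all_boot all_order all_algebra.
From mathcomp Require Import all_classical all_reals all_analysis.
From mathcomp Require Import complex.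
Set Implicit Arguments.
Unset Strict Implicit.
Unset Printing Implicit Defensive.
Import Order.TTheory GRing.Theory Num.Theory Num.Def.
Import numFieldNormedType.Exports.
Local Open Scope classical_set_scope.
Local Open Scope ring_scope.
Local Open Scope complex_scope.

Section SemiHilbertian.
Context {R : realType} {H : completeNormedModType R[i]}.
Variable dot : {dot H for conjC}.

Definition inner_norm : Prop := forall x : H, `|x| ^+ 2 = dot x x.

Definition bounded_operator (T : {linear H -> H}) : Prop :=
  bounded_near T (nbhs (0 : H)).

(* The order on [R[i]] is partial: [0 <= z] says that [z] is real and
   nonnegative. *)
Definition positive_operator (A : {linear H -> H}) : Prop :=
  forall x : H, 0 <= dot (A x) x.

(* The vector [z] is unique, and it exists when [T] is bounded. *)
Definition adjoint (T : H -> H) (y : H) : H :=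
  xget 0 [set z : H | forall x : H, dot (T x) y = dot x z].

(* For [y = A z + v] with [z] orthogonal to the kernel of [A] and [v]
   orthogonal to its range, the Moore-Penrose inverse sends [y] to [z].  Such a
   [z] is unique, and it exists exactly when [y] is in [R(A) + R(A)^\perp], the
   domain of the Moore-Penrose inverse; elsewhere the value is junk. *)
Definition moore_penrose (A : H -> H) (y : H) : H :=
  xget 0 [set z : H | (forall u : H, A u = 0 -> dot z u = 0) /\
                      (forall u : H, dot (y - A z) (A u) = 0)].

Variable A : {linear H -> H}.

Definition dotA (x y : H) : R[i] := dot (A x) y.

Definition normA (x : H) : R := Num.sqrt (complex.Re (dotA x x)).

Definition in_BA (T : {linear H -> H}) : Prop :=
  bounded_operator T /\
  exists W : {linear H -> H},
    bounded_operator W /\ forall x : H, A (W x) = adjoint T (A x).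

Definition sharp (T : H -> H) (x : H) : H :=
  moore_penrose A (adjoint T (A x)).

(* The unit sphere of the seminorm is empty when [A = 0]; the two suprema below
   are then [sup set0 = 0]. *)
Definition unit_sphereA : set H := [set x | normA x = 1].

Definition opnormA (T : H -> H) : R :=
  sup [set normA (T x) | x in unit_sphereA].

Definition omegaA (n : nat) (T : 'I_n -> {linear H -> H}) : R :=
  sup [set Num.sqrt (\sum_(k < n) complex.Re `|dotA (T k x) x| ^+ 2)
      | x in unit_sphereA].

End SemiHilbertian.

(* Main.v *)
(** On the unit sphere of the seminorm, Cauchy-Schwarz gives both
    [|<T x, x>_A|^2 <= <T^# T x, x>_A] and [|<T x, x>_A|^2 <= <T T^# x, x>_A];
    weighting them by [a / 2 + b] and [a / 2] and summing over the tuple gives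
    the first inequality, and the second one is the case [a = 2], [b = 0].

    As [A T^# = A W] for every solution [W] of [A W = T^* A], the operator
    [T^#] may be replaced by [W] under the seminorm.  Riesz representation and
    the projection on [ker A] ensure that [T^*] and [T^#] are not junk.  The
    operator norm is a supremum of a bounded set because a bounded
    [A]-selfadjoint map is bounded for the seminorm. *)
Require Import Defs.
From HB Require Import structures.
From mathcomp Require Import all_boot all_order all_algebra.
From mathcomp Require Import all_classical all_reals all_analysis.
From mathcomp Require Import complex.
From mathcomp Require Import ring lra.
Import Order.TTheory GRing.Theory Num.Theory Num.Def.
Import numFieldNormedType.Exports.
Local Open Scope classical_set_scope.
Local Open Scope ring_scope.
Local Open Scope complex_scope.

(** * Positive semidefinite forms and the Cauchy-Schwarz inequality *)

(** For [Q > 0] evaluate at [t = 1 / Q]; for [Q = 0] the polynomial is affine in [t], so its slope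
    must vanish. Allowing [Q = 0] is what serves degenerate forms. *)
Lemma discriminant_le (R : realFieldType) (m p Q : R) : 0 <= m -> 0 <= Q ->
  (forall t, 0 <= p - 2 * t * m + t ^+ 2 * m * Q) -> m <= p * Q.
Proof.
move=> m0 Q0 h.
have [Qp|Qn] := ltrP 0 Q.
  have := h Q^-1.
  have -> : p - 2 * Q^-1 * m + Q^-1 ^+ 2 * m * Q = (p * Q - m) / Q.
    by field; rewrite gt_eqF.
  by rewrite pmulr_lge0 ?invr_gt0// subr_ge0.
have Qe : Q = 0 by apply/le_anti; rewrite Qn.
rewrite Qe mulr0 leNgt; apply/negP => mp.
(* With [Q = 0] the polynomial is [p - 2 t m]; this [t] makes it [-1]. *)
have := h ((p + 1) / (2 * m)).
have -> : p - 2 * ((p + 1) / (2 * m)) * m + ((p + 1) / (2 * m)) ^+ 2 * m * Q = -1.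
  by rewrite Qe; field; rewrite gt_eqF.
by rewrite ler0N1.
Qed.

Lemma sqr_Re_norm (R : rcfType) (z : R[i]) :
  complex.Re `|z| ^+ 2 = complex.Re z ^+ 2 + complex.Im z ^+ 2.
Proof. by rewrite normc_def /= sqr_sqrtr ?addr_ge0 ?sqr_ge0. Qed.

Lemma sqr_Re_norm_le0 (R : rcfType) (z : R[i]) :
  (complex.Re `|z| ^+ 2 <= 0) = (z == 0).
Proof.
rewrite sqr_Re_norm eq_complex /= -[in RHS]sqrf_eq0 -[X in _ && X]sqrf_eq0.
by rewrite -paddr_eq0 ?sqr_ge0// eq_le addr_ge0 ?sqr_ge0// andbT.
Qed.

Section SemiInnerProduct.
Set Implicit Arguments.
Unset Strict Implicit.
Context {R : realType} {H : completeNormedModType R[i]}.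
Variable dot : {dot H for conjC}.
Variable A : {linear H -> H}.
Hypothesis A_positive : positive_operator dot A.

Local Notation dA := (dotA dot A).
Local Notation qA x := (complex.Re (dotA dot A x x)).

Lemma dotADl x y z : dA (x + y) z = dA x z + dA y z.
Proof. by rewrite /dotA linearD linearDl. Qed.

Lemma dotADr x y z : dA x (y + z) = dA x y + dA x z.
Proof. by rewrite /dotA linearDr. Qed.

Lemma dotAZl a x y : dA (a *: x) y = a * dA x y.
Proof. by rewrite /dotA linearZ linearZl_LR. Qed.

Lemma dotAZr a x y : dA x (a *: y) = a^* * dA x y.
Proof. by rewrite /dotA linearZr_LR. Qed.

Lemma dotAZr_real (r : R) x y : dA x (r%:C *: y) = r%:C * dA x y.
Proof.
rewrite dotAZr; congr (_ * _); apply/eqP.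
by rewrite eq_complex /= oppr0 !eqxx.
Qed.

Lemma dotA_suml n (f : 'I_n -> H) y :
  dA (\sum_(k < n) f k) y = \sum_(k < n) dA (f k) y.
Proof. by rewrite /dotA linear_sum linear_sumlz. Qed.

Lemma dotA_sumr n (f : 'I_n -> H) x :
  dA x (\sum_(k < n) f k) = \sum_(k < n) dA x (f k).
Proof. by rewrite /dotA linear_sumr. Qed.

Lemma dotA_ge0 x : 0 <= qA x.
Proof. by have := A_positive x; rewrite lecE => /andP[]. Qed.

Lemma Im_dotA x : complex.Im (dA x x) = 0.
Proof. by have := A_positive x; rewrite lecE => /andP[/eqP]. Qed.

(* Over the complex numbers a positive form is automatically hermitian, by
   polarization. *)
Lemma dotA_hermitian x y : dA y x = (dA x y)^*.
Proof.
have := Im_dotA (x + y); have := Im_dotA (x + 'i%C *: y).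
rewrite !(dotADl, dotADr, dotAZl, dotAZr).
have := Im_dotA x; have := Im_dotA y.
case: (dA x x) (dA y y) (dA x y) (dA y x) => [? ?] [? ?] [a b] [c d] /=.
move=> -> -> h1 h2; apply/eqP; rewrite eq_complex /=; apply/andP; split; apply/eqP; lra.
Qed.

(** Taking the coefficient along [dA x y] makes the cross terms real, so a real parameter [t]
    suffices over the complex numbers. *)
Lemma dotA_sub_scale x y (t : R) :
  let c := t%:C * dA x y in
  qA (x - c *: y) = qA x - 2 * t * complex.Re `|dA x y| ^+ 2
                    + t ^+ 2 * complex.Re `|dA x y| ^+ 2 * qA y.
Proof.
rewrite /= -scaleNr !(dotADl, dotADr, dotAZl, dotAZr) (dotA_hermitian x y) sqr_Re_norm.
have := Im_dotA y.
case: (dA x x) (dA y y) (dA x y) => [? ?] [? ?] [a b] /= ->; ring.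
Qed.

Lemma cauchy_schwarz_dotA x y : complex.Re `|dA x y| ^+ 2 <= qA x * qA y.
Proof.
apply: discriminant_le; rewrite ?sqr_ge0 ?dotA_ge0// => t.
by rewrite -dotA_sub_scale dotA_ge0.
Qed.

Lemma normA_ge0 x : 0 <= normA dot A x.
Proof. exact: sqrtr_ge0. Qed.

Lemma sqr_normA x : normA dot A x ^+ 2 = qA x.
Proof. by rewrite sqr_sqrtr ?dotA_ge0. Qed.

Lemma Re_dotA_le x y : complex.Re (dA x y) <= normA dot A x * normA dot A y.
Proof.
apply: (le_trans (ler_norm _)).
rewrite -(@ler_pXn2r _ 2) ?nnegrE ?mulr_ge0 ?normA_ge0//.
rewrite exprMn !sqr_normA real_normK ?num_real//.
apply: le_trans (cauchy_schwarz_dotA x y).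
by rewrite sqr_Re_norm lerDl sqr_ge0.
Qed.

End SemiInnerProduct.

(** * Geometry of the inner product *)

Section HilbertSpace.
Set Implicit Arguments.
Unset Strict Implicit.
Context {R : realType} {H : completeNormedModType R[i]}.
Variable dot : {dot H for conjC}.
Hypothesis dot_norm : inner_norm dot.

Lemma dot_hermitian x y : dot y x = (dot x y)^*.
Proof. by rewrite hermC mul1r. Qed.

(** For [A = idfun] the form [dotA] is [dot] itself, so the results on semi-inner products apply to
    the inner product. *)
Lemma idfun_positive : positive_operator dot (idfun : {linear H -> H}).
Proof. by move=> x; rewrite /= dnorm_ge0. Qed.

Local Notation q x := (complex.Re (dot x x)).

Lemma sqr_normE (x : H) : `|x| ^+ 2 = (q x)%:C.
Proof. by rewrite dot_norm RRe_real// ger0_real// dnorm_ge0. Qed.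

Lemma norm_ReE (x : H) : `|x| = (complex.Re `|x|)%:C.
Proof. by rewrite RRe_real// normr_real. Qed.

Lemma sqr_Re_normE (x : H) : complex.Re `|x| ^+ 2 = q x.
Proof. by apply: complexI; rewrite -sqr_normE [in RHS]norm_ReE -rmorphXn. Qed.

Lemma Re_norm_ge0 (x : H) : 0 <= complex.Re `|x|.
Proof. by rewrite -ler0c -norm_ReE. Qed.

Lemma parallelogram x y : q (x + y) + q (x - y) = 2 * (q x + q y).
Proof.
rewrite !(linearDl, linearDr, linearNl, linearNr) /= (dot_hermitian x y).
by case: (dot x x) (dot y y) (dot x y) => [? ?] [? ?] [? ?] /=; ring.
Qed.

(** * Orthogonal projection onto a closed subspace *)

Section Projection.
Variable K : set H.
Hypothesis K0 : K 0.
Hypothesis K_linear : forall (a : R[i]) x y, K x -> K y -> K (a *: x + y).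
Hypothesis K_closed : closed K.
Variable w : H.

Local Notation dist2 := [set q (w - x) | x in K].

Lemma dist2_has_inf : has_inf dist2.
Proof.
split; first by exists (q (w - 0)), 0.
by exists 0 => _ [x _ <-]; exact: (dotA_ge0 idfun_positive).
Qed.

(** Parallelogram law for [w - x] and [w - y]: the midpoint of [x] and [y] lies in [K], so its
    squared distance to [w] is at least the infimum. *)
Lemma near_minimizers_close e x y : K x -> K y ->
  q (w - x) < inf dist2 + e -> q (w - y) < inf dist2 + e -> q (x - y) <= 4 * e.
Proof.
move=> Kx Ky dx dy.
have Kz : K (2^-1 *: (x + y)).
  rewrite -[_ *: _]addr0; apply: K_linear => //.
  by rewrite -(scale1r x); exact: K_linear.
have : inf dist2 <= q (w - 2^-1 *: (x + y)).
  by apply: ge_inf; [exact: dist2_has_inf.2 | exists (2^-1 *: (x + y))].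
have := parallelogram (w - x) (w - y).
have -> : w - x - (w - y) = - (x - y) by rewrite opprB addrC addrA subrK opprB.
have -> : w - x + (w - y) = 2 *: (w - 2^-1 *: (x + y)).
  rewrite scalerBr scalerA divff// scale1r opprD scalerDl scale1r.
  by rewrite addrACA.
rewrite hnormN dnormZ normr_nat -natrX -(rmorph_nat (real_complex R)).
case: (dot (w - 2^-1 *: (x + y)) _) => ? ? /=; lra.
Qed.

(** Moving [x] along [u] inside [K] lowers the squared distance by at most [e]; this is the
    hypothesis of [discriminant_le] with [p = e]. *)
Lemma near_minimizer_orthogonal e x u : K x -> K u ->
  q (w - x) < inf dist2 + e ->
  complex.Re `|dot (w - x) u| ^+ 2 <= e * q u.
Proof.
move=> Kx Ku dx; apply: discriminant_le.
- exact: sqr_ge0.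
- exact: (dotA_ge0 idfun_positive).
move=> t; have := dotA_sub_scale idfun_positive (w - x) u t.
rewrite /dotA /=; set c := _ * dot _ _ => E.
have : inf dist2 <= q (w - (c *: u + x)).
  apply: ge_inf; first exact: dist2_has_inf.2.
  by exists (c *: u + x) => //; exact: K_linear.
rewrite opprD addrCA addrC E; lra.
Qed.

(** The limit [p] of a minimizing sequence is not shown to be a minimizer: near-minimizers
    arbitrarily close to it suffice for orthogonality, which avoids continuity of the squared
    distance. *)
Lemma approx_projection : exists2 p, K p &
  forall e, 0 < e -> exists x, [/\ K x, q (w - x) < inf dist2 + e & q (x - p) < e].
Proof.
have /choice[x xP] (n : nat) : exists x, K x /\ q (w - x) < inf dist2 + n.+1%:R^-1.
  have [|_ [x Kx <-] dx] := @inf_adherent _ dist2 n.+1%:R^-1 _ dist2_has_inf.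
    by rewrite invr_gt0.
  by exists x.
have xlt e n m : 0 < e -> (truncn e^-1 <= n)%N -> (n <= m)%N ->
    q (w - x m) < inf dist2 + e.
  move=> e0 en nm; have [_ /lt_le_trans] := xP m; apply.
  rewrite lerD2l invf_ple ?posrE//.
  apply: (le_trans (ltW (truncnS_gt _))); rewrite ler_nat ltnS.
  exact: leq_trans nm.
have : cvg (x @ \oo).
  apply: cauchy_cvg; apply: cauchy_exP => e e0.
  have [r r0 ->] : exists2 r : R, 0 < r & e = r%:C.
    have er : e = (complex.Re e)%:C by rewrite RRe_real// gtr0_real.
    by exists (complex.Re e) => //; rewrite -ltcR -er.
  (* Near-minimizers within [r ^+ 2 / 5] are at squared distance at most
     [4 * (r ^+ 2 / 5) < r ^+ 2]. *)
  have r20 : 0 < r ^+ 2 / 5 by rewrite divr_gt0 ?exprn_gt0.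
  exists (x (truncn (r ^+ 2 / 5)^-1)); exists (truncn (r ^+ 2 / 5)^-1) => // m /= nm.
  rewrite -ball_normE /ball_ /= norm_ReE ltcR.
  rewrite -(@ltr_pXn2r _ 2) ?nnegrE ?Re_norm_ge0 ?(ltW r0)// sqr_Re_normE.
  have Ex := xlt _ _ _ r20 (leqnn _) nm.
  have Ey := xlt _ _ _ r20 (leqnn _) (leqnn _).
  have := near_minimizers_close (xP _).1 (xP _).1 Ey Ex.
  by move=> /le_lt_trans; apply; lra.
move=> /cvg_ex[/= p xp]; exists p.
  apply: (closed_cvg _ K_closed _ _ xp).
  by apply: nearW => n; exact: (xP n).1.
move=> e e0.
have s0 : (0 : R[i]) < (Num.sqrt e)%:C by rewrite ltcR sqrtr_gt0.
have /cvgrPdist_lt/(_ _ s0)[N _ NP] := xp.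
(* [N] gives closeness to [p], [truncn e^-1] gives near-minimality. *)
exists (x (maxn N (truncn e^-1))); split; first exact: (xP _).1.
- by apply: (xlt _ (truncn e^-1)) => //; rewrite leq_maxr.
have := NP (maxn N (truncn e^-1)) (leq_maxl _ _).
rewrite /= distrC norm_ReE ltcR -(@ltr_pXn2r _ 2) ?nnegrE ?Re_norm_ge0 ?sqrtr_ge0//.
by rewrite sqr_Re_normE sqr_sqrtr// ltW.
Qed.

Lemma orthogonal_projection : exists2 p, K p & forall u, K u -> dot (w - p) u = 0.
Proof.
have [p Kp pP] := approx_projection; exists p => // u Ku.
apply/eqP; rewrite -sqr_Re_norm_le0.
have qu0 : 0 <= q u := dotA_ge0 idfun_positive u.
apply/ler_addgt0Pl => e e0; rewrite addr0.
(* Both parts of [w - p = (w - x) + (x - p)] then have a squared product with [u] of at most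
   [e / 4], and the square of a sum is at most twice the sum of squares. The [+ 1] covers
   [q u = 0]. *)
have d0 : 0 < e / (4 * (q u + 1)) by rewrite divr_gt0// mulr_gt0// ltr_wpDl.
have [x [Kx dx xp]] := pP _ d0.
have h1 := near_minimizer_orthogonal Kx Ku dx.
have h2 : complex.Re `|dot (x - p) u| ^+ 2 <= q (x - p) * q u.
  exact: (cauchy_schwarz_dotA idfun_positive).
have h3 : q (x - p) * q u <= e / (4 * (q u + 1)) * q u by rewrite ler_wpM2r// ltW.
have h4 : 4 * (e / (4 * (q u + 1)) * q u) <= e.
  have -> : 4 * (e / (4 * (q u + 1)) * q u) = e * (q u / (q u + 1)).
    by field; rewrite gt_eqF// ltr_wpDl.
  by rewrite ger_pMr// ler_pdivrMr ?ltr_wpDl// mul1r lerDl.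
have -> : w - p = (w - x) + (x - p) by rewrite addrA subrK.
rewrite linearDl /=; move: h1 h2; rewrite !sqr_Re_norm.
case: (dot (w - x) u) (dot (x - p) u) => [a b] [c d] /= h1 h2.
have := sqr_ge0 (a - c); have := sqr_ge0 (b - d).
nra.
Qed.

End Projection.

(** * Riesz representation and adjoints *)

(** If [dot p y] is nonzero, Cauchy-Schwarz keeps a ball around [p] off the hyperplane, since
    [dot (p - x) y = dot p y] for [x] on it. *)
Lemma hyperplane_closed y : closed [set x | dot x y = 0].
Proof.
move=> p clp; apply: contrapT => py.
pose m := complex.Re `|dot p y| ^+ 2.
have m0 : 0 < m by rewrite ltNge sqr_Re_norm_le0; apply/eqP.
have qy0 : 0 <= q y := dotA_ge0 idfun_positive y.
have r0 : 0 < m / (q y + 1) by rewrite divr_gt0// ltr_wpDl.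
have s0 : (0 : R[i]) < (Num.sqrt (m / (q y + 1)))%:C by rewrite ltcR sqrtr_gt0.
have [x [/= xy]] := clp _ (nbhsx_ballx p _ s0).
rewrite -ball_normE /ball_ /= norm_ReE ltcR.
rewrite -(@ltr_pXn2r _ 2) ?nnegrE ?Re_norm_ge0 ?sqrtr_ge0//.
rewrite sqr_Re_normE sqr_sqrtr ?(ltW r0)// => px.
have := cauchy_schwarz_dotA idfun_positive (p - x) y.
rewrite /dotA /= linearBl /= xy subr0 -/m.
have : q (p - x) * q y <= m / (q y + 1) * q y by rewrite ler_wpM2r// ltW.
move=> /[swap] /le_trans /[apply]; rewrite leNgt => /negP; apply.
by rewrite mulrAC -mulrA gtr_pMr// ltr_pdivrMr ?ltr_wpDl// mul1r ltrDl.
Qed.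

(** Continuity enters only as closedness of the kernel, which is what the projection needs;
    [adjointP] obtains it as a preimage of a hyperplane. *)
Lemma riesz_representation (f : H -> R[i]) :
  (forall a x y, f (a *: x + y) = a * f x + f y) -> closed [set x | f x = 0] ->
  exists z, forall x, f x = dot x z.
Proof.
move=> f_linear ker_closed.
have [f0|/existsNP[w fw]] := pselect (forall x, f x = 0).
  by exists 0 => x; rewrite f0 linear0r.
have f00 : f 0 = 0.
  by have := f_linear (-1) 0 0; rewrite scaler0 addr0 mulN1r addNr.
have ker_linear a x y : f x = 0 -> f y = 0 -> f (a *: x + y) = 0.
  by move=> fx fy; rewrite f_linear fx fy mulr0 addr0.
have [p /= fp orth] := orthogonal_projection f00 ker_linear ker_closed w.
set u := w - p in orth.
have fu : f u = f w by rewrite /u addrC -scaleN1r f_linear fp mulr0 add0r.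
have u0 : dot u u != 0.
  by rewrite dnorm_eq0; apply/eqP => u0; apply: fw; rewrite -fu u0.
exists ((f u / dot u u)^* *: u) => x.
(* This combination lies in the kernel, hence is orthogonal to [u]; solving for [f x] gives the
   representing vector. *)
have fxu : f (f u *: x - f x *: u) = 0.
  by rewrite f_linear -scaleNr -[_ *: u]addr0 f_linear f00 addr0 mulNr mulrC subrr.
have : dot (f u *: x - f x *: u) u = 0 by rewrite dot_hermitian orth// conjc0.
rewrite linearBl /= !linearZl_LR linearZr_LR /= => /eqP; rewrite subr_eq0 => /eqP h.
by rewrite conjCK mulrAC h mulfK.
Qed.

Lemma bounded_operatorP (T : {linear H -> H}) : bounded_operator T ->
  exists M : R, forall x, complex.Re `|T x| <= M * complex.Re `|x|.
Proof.
move=> /linear_boundedP/pinfty_ex_gt0[r r0 rT]; exists (complex.Re r) => x.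
rewrite -lecR -norm_ReE (le_trans (rT x))//.
by rewrite rmorphM /= -norm_ReE RRe_real ?gtr0_real.
Qed.

Lemma adjointP (T : {linear H -> H}) x y : bounded_operator T ->
  dot (T x) y = dot x (adjoint dot T y).
Proof.
move=> T_bounded.
have [||z zP] := @riesz_representation (fun x => dot (T x) y) _ _.
- by move=> a u v; rewrite linearP linearDl linearZl_LR.
- have := bounded_linear_continuous T_bounded => T_cont.
  apply: (@preimage_closed _ _ T [set v | dot v y = 0]); last exact: hyperplane_closed.
  by move=> u _; exact: T_cont.
by rewrite /adjoint; case: xgetP => [u -> //|/(_ z)]; case.
Qed.

End HilbertSpace.

(** * Boundedness of selfadjoint maps for the seminorm *)

(** If [s > M], Bernoulli's inequality makes the powers of [s / M] unbounded, whereas [C] bounds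
    those with exponent [2 ^ j]. *)
Lemma le_of_expn_le (R : archiRealFieldType) (s C M : R) : 0 < M ->
  (forall j, s ^+ (2 ^ j) <= C * M ^+ (2 ^ j)) -> s <= M.
Proof.
move=> M0 h; rewrite leNgt; apply/negP => Ms.
pose d := s / M - 1.
have d0 : 0 < d by rewrite subr_gt0 ltr_pdivlMr// mul1r.
have sM : s / M = d + 1 by rewrite subrK.
have bernoulli k : 1 + k%:R * d <= (s / M) ^+ k.
  elim: k => [|k IH]; first by rewrite mul0r addr0 expr0.
  rewrite exprS [X in _ <= X * _]sM -natr1.
  have := ler_wpM2l (ltW (addr_gt0 d0 ltr01)) IH.
  have : 0 <= k%:R * d * d by rewrite !mulr_ge0 ?ler0n// ltW.
  by lra.
have Cj j : (s / M) ^+ (2 ^ j) <= C by rewrite expr_div_n ler_pdivrMr ?exprn_gt0.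
have C0 : 0 <= C / d.
  rewrite divr_ge0 ?(ltW d0)//; apply: le_trans (Cj 0).
  by rewrite exprn_ge0// divr_ge0 ?ltW// (lt_trans M0).
have := archi_boundP C0; set n := Num.bound _; rewrite ltr_pdivrMr// => Cn.
have := le_trans (bernoulli _) (Cj n).
have : n%:R * d <= (2 ^ n)%:R * d.
  by rewrite ler_wpM2r ?(ltW d0)// ler_nat ltnW// ltn_expl.
lra.
Qed.

Section SemiHilbertSpace.
Set Implicit Arguments.
Unset Strict Implicit.
Context {R : realType} {H : completeNormedModType R[i]}.
Variable dot : {dot H for conjC}.
Hypothesis dot_norm : inner_norm dot.
Variable A : {linear H -> H}.
Hypothesis A_bounded : bounded_operator A.
Hypothesis A_positive : positive_operator dot A.

Local Notation dA := (dotA dot A).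
Local Notation nA := (normA dot A).

(** Stated for bare functions because the weighted sums [Q] below are not bundled as linear maps.
    The sign of [M] is free, hence the later [Num.max]. *)
Definition bounded_map (f : H -> H) : Prop :=
  exists M : R, forall x, complex.Re `|f x| <= M * complex.Re `|x|.

Lemma bounded_map_comp f g :
  bounded_map f -> bounded_map g -> bounded_map (f \o g).
Proof.
move=> [M fM] [N gN]; exists (Num.max M 0 * N) => x /=.
apply: (le_trans (fM _)).
apply: (@le_trans _ _ (Num.max M 0 * complex.Re `|g x|)).
  by rewrite ler_wpM2r ?Re_norm_ge0// le_max lexx.
by rewrite -mulrA ler_wpM2l ?gN// le_max lexx orbT.
Qed.

Lemma Re_norm_le_add (x y : H) :
  complex.Re `|x + y| <= complex.Re `|x| + complex.Re `|y|.
Proof. by rewrite -lecR rmorphD /= -!norm_ReE ler_normD. Qed.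

Lemma bounded_map_add f g :
  bounded_map f -> bounded_map g -> bounded_map (fun x => f x + g x).
Proof.
move=> [M fM] [N gN]; exists (M + N) => x.
by rewrite (le_trans (Re_norm_le_add _ _))// mulrDl lerD.
Qed.

Lemma bounded_map_scale (a : R[i]) f :
  bounded_map f -> bounded_map (fun x => a *: f x).
Proof.
move=> [M fM]; have /complex_realP[N aN] := normr_real a; exists (N * M) => x.
rewrite -lecR -norm_ReE normrZ aN (norm_ReE (f x)) -mulrA.
by rewrite -rmorphM lecR ler_wpM2l// -ler0c -aN.
Qed.

Lemma bounded_map_sum n (f : 'I_n -> H -> H) :
  (forall k, bounded_map (f k)) -> bounded_map (fun x => \sum_(k < n) f k x).
Proof.
elim: n f => [|n IH] f fb.
  by exists 0 => x; rewrite big_ord0 normr0 mul0r.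
under eq_fun do rewrite big_ord_recl.
by apply: bounded_map_add; [exact: fb | exact: IH].
Qed.

Lemma bounded_map_iter f : bounded_map f -> exists2 M : R, 0 < M &
  forall k x, complex.Re `|iter k f x| <= M ^+ k * complex.Re `|x|.
Proof.
move=> [M fM]; exists (Num.max M 1); first by rewrite lt_max ltr01 orbT.
elim=> [|j IH] x; first by rewrite expr0 mul1r.
rewrite exprS -mulrA iterS (le_trans (fM _))//.
apply: (@le_trans _ _ (Num.max M 1 * complex.Re `|iter j f x|)).
  by rewrite ler_wpM2r ?Re_norm_ge0// le_max lexx.
by rewrite ler_wpM2l ?IH// le_max ler01 orbT.
Qed.

Lemma normA_le_norm : exists2 c : R, 0 <= c & forall x, nA x <= c * complex.Re `|x|.
Proof.
have [M AM] := bounded_operatorP A_bounded.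
exists (Num.sqrt (Num.max M 0)); first exact: sqrtr_ge0.
move=> x; rewrite -(@ler_pXn2r _ 2) ?nnegrE ?normA_ge0//; last first.
  by rewrite mulr_ge0 ?sqrtr_ge0 ?Re_norm_ge0.
have M0 : 0 <= Num.max M 0 by rewrite le_max lexx orbT.
rewrite (sqr_normA A_positive) exprMn sqr_sqrtr//.
have := Re_dotA_le (idfun_positive dot) (A x) x.
rewrite {1}/dotA /= => /le_trans; apply.
have idE y : normA dot idfun y = complex.Re `|y|.
  rewrite /normA /dotA /= -(sqr_Re_normE dot_norm) sqrtr_sqr.
  by rewrite ger0_norm// Re_norm_ge0.
rewrite !idE expr2 mulrA ler_wpM2r ?Re_norm_ge0//.
by rewrite (le_trans (AM _))// ler_wpM2r ?Re_norm_ge0// le_max lexx.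
Qed.

(* Selfadjointness gives [nA (Q^m x) ^+ 2 <= nA (Q^(2m) x)] on the unit sphere,
   so [nA (Q x) ^+ (2 ^ j)] grows at most like the [2 ^ j]-th power of the norm
   bound of [Q]. *)
Lemma normA_selfadjoint_bounded (Q : H -> H) : bounded_map Q ->
  (forall x y, dA (Q x) y = dA x (Q y)) ->
  exists M, forall x, nA x = 1 -> nA (Q x) <= M.
Proof.
move=> Qb Qsa.
have [M M0 QM] := bounded_map_iter Qb; have [c c0 cA] := normA_le_norm.
exists M => x x1; apply: (@le_of_expn_le _ _ (c * complex.Re `|x|)) => // j.
apply: (@le_trans _ _ (nA (iter (2 ^ j) Q x))); last first.
  by rewrite (le_trans (cA _))// -mulrA ler_wpM2l// mulrC QM.
have iter_sa k y z : dA (iter k Q y) z = dA y (iter k Q z).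
  by elim: k y z => // k IH y z; rewrite iterS Qsa IH -iterSr.
elim: j => [|j IH]; first by rewrite expn0 expr1.
rewrite expnS mulnC exprM.
apply: (@le_trans _ _ (nA (iter (2 ^ j) Q x) ^+ 2)).
  by rewrite ler_pXn2r// nnegrE ?exprn_ge0// ?normA_ge0.
rewrite (sqr_normA A_positive) -iter_sa -iterD addnn -muln2.
by rewrite (le_trans (Re_dotA_le A_positive _ _))// x1 mulr1.
Qed.

(** * Solutions [W] of [A W = T^* A] and the operator [T^#] *)

Section Sharp.
Variables (T W : {linear H -> H}).
Hypothesis T_bounded : bounded_operator T.
Hypothesis W_adjoint : forall x, A (W x) = adjoint dot T (A x).

Lemma dotA_adjoint x y : dA (W x) y = dA x (T y).
Proof.
rewrite /dotA W_adjoint dot_hermitian -(adjointP dot_norm)//.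
by rewrite -dot_hermitian.
Qed.

Lemma dotA_adjointr x y : dA (T x) y = dA x (W y).
Proof.
by rewrite (dotA_hermitian A_positive) -dotA_adjoint -(dotA_hermitian A_positive).
Qed.

(** Subtracting from [W x] its projection on the kernel of [A] gives a vector meeting the
    Moore-Penrose conditions, so the choice is not the default. For any such [z], [A (W x) - A z]
    lies in the range of [A] and is orthogonal to it. *)
Lemma A_sharp x : A (sharp dot A T x) = A (W x).
Proof.
have [||p /= Ap orth] := @orthogonal_projection _ _ _ dot_norm
  [set u | A u = 0] (linear0 A) _ _ (W x).
- by move=> a u v /= Au Av; rewrite linearP Au Av scaler0 addr0.
- apply: (@preimage_closed _ _ A [set 0]).
    by move=> u _; exact: bounded_linear_continuous.
  exact/accessible_closed_set1/hausdorff_accessible/norm_hausdorff.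
rewrite /sharp /moore_penrose -W_adjoint.
case: xgetP => [z _ [_ zP]|/(_ (W x - p))]; last first.
  case; split => [u Au|u]; first exact: orth.
  by rewrite linearB /= Ap subr0 subrr linear0l.
have : A (W x) - A z == 0.
  rewrite -(dnorm_eq0 dot) -{2}linearB; apply/eqP; exact: zP.
by rewrite subr_eq0 => /eqP ->.
Qed.

Lemma sqr_numerical_le x : nA x = 1 ->
  complex.Re `|dA (T x) x| ^+ 2 <= complex.Re (dA (W (T x)) x) /\
  complex.Re `|dA (T x) x| ^+ 2 <= complex.Re (dA (T (W x)) x).
Proof.
move=> x1; have qx1 : complex.Re (dA x x) = 1.
  by rewrite -(sqr_normA A_positive) x1 expr1n.
split.
  have := cauchy_schwarz_dotA A_positive (T x) x.
  by rewrite qx1 mulr1 dotA_adjoint.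
have := cauchy_schwarz_dotA A_positive x (W x).
by rewrite qx1 mul1r !dotA_adjointr.
Qed.

(** With [u = x - y] in the kernel of [A], moving [T] across the form turns the squared norm of
    [A (T u)] into a product with [A u = 0]. This permits replacing [T^#] by [W] underneath [T]. *)
Lemma A_congr x y : A x = A y -> A (T x) = A (T y).
Proof.
move=> Axy; apply/eqP; rewrite -subr_eq0 -!linearB /= -(dnorm_eq0 dot).
apply/eqP; rewrite -[LHS]/(dA (T (x - y)) (A (T (x - y)))) dotA_adjointr.
by rewrite /dotA linearB /= Axy subrr linear0l.
Qed.

End Sharp.

Lemma opnormA_ge0 f : 0 <= opnormA dot A f.
Proof.
rewrite /opnormA; set E := [set _ | _ in _].
(* If the set is empty or unbounded, [sup] takes the default value 0. *)
have [[[_ [x Ax _]] f_ub]|/sup_out->//] := pselect (has_sup E).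
by apply: (le_trans (normA_ge0 dot A (f x))); apply: ub_le_sup => //; exists x.
Qed.

Lemma eq_opnormA f g : (forall x, A (f x) = A (g x)) ->
  opnormA dot A f = opnormA dot A g.
Proof.
move=> fg; congr (sup _); apply: eq_imagel => x _.
rewrite /normA /dotA fg; congr (Num.sqrt _).
(* The hypothesis only changes the argument under [A]; hermitian symmetry exchanges the other
   one. *)
have := dotA_hermitian A_positive (g x) (f x); rewrite /dotA fg => ->.
by case: (dot _ _).
Qed.

(** * Weighted sums over the tuple *)

Section Tuple.
Variables (n : nat) (T W : 'I_n -> {linear H -> H}).
Hypothesis T_bounded : forall k, bounded_operator (T k).
Hypothesis W_bounded : forall k, bounded_operator (W k).
Hypothesis W_adjoint : forall k x, A (W k x) = adjoint dot (T k) (A x).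
Variables c d : R.

Local Notation Q := (fun x =>
  \sum_(k < n) (c%:C *: W k (T k x) + d%:C *: T k (W k x))).

Lemma opnormA_sharp_sum :
  opnormA dot A (fun x => \sum_(k < n)
    (c%:C *: sharp dot A (T k) (T k x) + d%:C *: T k (sharp dot A (T k) x))) =
  opnormA dot A Q.
Proof.
apply: eq_opnormA => x; rewrite !linear_sum; apply: eq_bigr => k _.
rewrite !linearD !linearZ /= !(A_sharp (W_adjoint k)).
by rewrite (A_congr (T_bounded k) (W_adjoint k) (A_sharp (W_adjoint k) x)).
Qed.

Lemma adjoint_sum_bounded : bounded_map Q.
Proof.
apply: bounded_map_sum => k; apply: bounded_map_add; apply: bounded_map_scale;
  by apply: bounded_map_comp; exact: bounded_operatorP.
Qed.

(** [W T] and [T W] are each selfadjoint for the form, and the weights are real. *)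
Lemma adjoint_sum_selfadjoint x y : dA (Q x) y = dA x (Q y).
Proof.
rewrite dotA_suml dotA_sumr; apply: eq_bigr => k _.
rewrite dotADl dotADr !dotAZl !dotAZr_real.
have ad := dotA_adjoint (T_bounded k) (W_adjoint k).
have adr := dotA_adjointr (T_bounded k) (W_adjoint k).
by rewrite !ad !adr !ad.
Qed.

Lemma normA_adjoint_sum_le x : nA x = 1 -> nA (Q x) <= opnormA dot A Q.
Proof.
move=> x1; apply: ub_le_sup; last by exists x.
have [M QM] := normA_selfadjoint_bounded adjoint_sum_bounded adjoint_sum_selfadjoint.
by exists M => _ [y y1 <-]; exact: QM.
Qed.

Lemma sum_numerical_le x : 0 <= c -> 0 <= d -> nA x = 1 ->
  (c + d) * \sum_(k < n) complex.Re `|dA (T k x) x| ^+ 2 <= opnormA dot A Q.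
Proof.
move=> c0 d0 x1; apply: le_trans (normA_adjoint_sum_le x1).
apply: (@le_trans _ _ (complex.Re (dA (Q x) x))); last first.
  by rewrite (le_trans (Re_dotA_le A_positive _ _))// x1 mulr1.
(* Viewing the codomain of [dA] as [Rcomplex] makes [Re] additive over the sum. *)
rewrite dotA_suml mulr_sumr (raddf_sum (@complex.Re R : Rcomplex R -> R)).
apply: ler_sum => k _.
have [h1 h2] := sqr_numerical_le (T_bounded k) (W_adjoint k) x1.
rewrite dotADl !dotAZl mulrDl.
apply: (le_trans (lerD (ler_wpM2l c0 h1) (ler_wpM2l d0 h2))).
by case: (dA (W k (T k x)) x) (dA (T k (W k x)) x) => [? ?] [? ?] /=; lra.
Qed.

End Tuple.

End SemiHilbertSpace.

Theorem corollary3p19 (R : realType) (H : completeNormedModType R[i])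
    (dot : {dot H for conjC}) (dot_norm : inner_norm dot)
    (H_nontrivial : exists x : H, x != 0)
    (A : {linear H -> H}) (A_bounded : bounded_operator A)
    (A_positive : positive_operator dot A)
    (n : nat) (n_ge1 : (1 <= n)%N)
    (T : 'I_n -> {linear H -> H}) (T_BA : forall k, in_BA dot A (T k)) :
  let Tsharp k := sharp dot A (T k) in
  let bound (a b : R) : R :=
    (Num.sqrt (a + b))^-1 *
    Num.sqrt (opnormA dot A (fun x =>
      \sum_(k < n) ((a / 2 + b)%:C *: Tsharp k (T k x)
                    + (a / 2)%:C *: T k (Tsharp k x)))) in
  let infimum : R :=
    inf [set bound ab.1 ab.2
        | ab in [set ab : R * R | [/\ 0 <= ab.1, 0 <= ab.2 & ab != (0, 0)]]] in
  omegaA dot A T <= infimum /\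
  infimum <= (Num.sqrt 2)^-1 *
    Num.sqrt (opnormA dot A (fun x =>
      \sum_(k < n) (Tsharp k (T k x) + T k (Tsharp k x)))).
Proof.
move=> Tsharp bound infimum.
have T_bounded k : bounded_operator (T k) := (T_BA k).1.
have /choice[W WP] k := (T_BA k).2.
have W_bounded k : bounded_operator (W k) := (WP k).1.
have W_adjoint k := (WP k).2.
have bound_ge0 a b : 0 <= bound a b by rewrite mulr_ge0 ?invr_ge0 ?sqrtr_ge0.
have bound20 : bound 2 0 = (Num.sqrt 2)^-1 *
    Num.sqrt (opnormA dot A (fun x =>
      \sum_(k < n) (Tsharp k (T k x) + T k (Tsharp k x)))).
  rewrite /bound !addr0 divff//; congr (_ * Num.sqrt (opnormA _ _ _)).
  by apply/funext => x; apply: eq_bigr => k _; rewrite !scale1r.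
have bound20_in : [set bound ab.1 ab.2
    | ab in [set ab : R * R | [/\ 0 <= ab.1, 0 <= ab.2 & ab != (0, 0)]]] (bound 2 0).
  by exists (2, 0) => //=; split => //; rewrite xpair_eqE pnatr_eq0.
split; last first.
  rewrite -bound20; apply: ge_inf; last exact: bound20_in.
  by exists 0 => _ [[a b] _ <-]; exact: bound_ge0.
apply: lb_le_inf; first by exists (bound 2 0).
move=> _ [[a b] /= [a0 b0 ab0] <-].
have ab_gt0 : 0 < a + b by rewrite lt_def addr_ge0// andbT paddr_eq0.
(* An empty unit sphere makes [omegaA] equal to [sup set0 = 0], while [ge_sup] requires a nonempty
   set. *)
have [e|/set0P sphere_neq0] := eqVneq (unit_sphereA dot A) set0.
  by rewrite /omegaA e image_set0 sup0.
apply: ge_sup; first exact: image_nonempty.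
move=> _ [x x1 <-].
rewrite /bound [leRHS]mulrC -sqrtrV ?(ltW ab_gt0)// -sqrtrM ?opnormA_ge0//.
rewrite ler_wsqrtr// ler_pdivlMr// mulrC.
rewrite (opnormA_sharp_sum dot_norm A_bounded A_positive T_bounded W_adjoint).
(* The weights are [c = a / 2 + b] and [d = a / 2], whose sum is [a + b]. *)
apply: le_trans (sum_numerical_le dot_norm A_bounded A_positive
  T_bounded W_bounded W_adjoint _ _ x1).
- by rewrite addrAC -splitr.
- by rewrite addr_ge0// divr_ge0.
- by rewrite divr_ge0.
Qed.
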